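(* Let $f:\{-1,1\}^5\to\{-1,1\}$ be the function $f(x_1,\ldots,x_5)=\operatorname{sgn}(x_1-3x_2+x_3-x_4+3x_5)$ (the argument of $\operatorname{sgn}$ is never $0$ on $\{-1,1\}^5$, and $f(-x)=-f(x)$, so $f$ is unbiased), and let $\mathrm{Maj}_5(x)=\operatorname{sgn}(x_1+x_2+x_3+x_4+x_5)$ on $\{-1,1\}^5$. Then for $p=0.40=\tfrac25$, $$\Phi_{0.40}(f)=\frac{2689}{6250}=0.43024,\qquad \Phi_{0.40}(\mathrm{Maj}_5)=\frac{5363}{12500}=0.42904,$$ hence $\Phi_{0.40}(f)>\Phi_{0.40}(\mathrm{Maj}_5)$. In particular, for $n=5$ and $p=0.4$, $\mathrm{Maj}_5$ does not maximize $\Phi_p$ over unbiased Boolean functions on $\{-1,1\}^5$.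
   Context: The hypercube $\{-1,1\}^n$ carries the uniform probability measure. A Boolean function is a map $f:\{-1,1\}^n\to\{-1,1\}$; it is unbiased if $\mathbb{E}[f]=0$. Here $\operatorname{sgn}(t)=1$ for $t>0$ and $\operatorname{sgn}(t)=-1$ for $t<0$. Every $f$ has a unique multilinear extension $f(z)=\sum_{S\subseteq[n]}\widehat f(S)\prod_{i\in S}z_i$, $z\in[-1,1]^n$, where $\widehat f(S)=\mathbb{E}[f(x)\prod_{i\in S}x_i]$ with $x$ uniform on $\{-1,1\}^n$. Erasure model: for $p\in(0,1)$, let $z\in\{-1,0,1\}^n$ be random with independent coordinates satisfying $\Pr[z_i=1]=\Pr[z_i=-1]=\tfrac p2$ and $\Pr[z_i=0]=1-p$. Define $\Phi_p(f):=\mathbb{E}_z\big[|f(z)|\big]$, where $f(z)$ is the multilinear extension of $f$ evaluated at $z$. *)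

(* Defs.v *)
From mathcomp Require Import all_boot all_order all_algebra.
Set Implicit Arguments.
Unset Strict Implicit.
Unset Printing Implicit Defensive.
Import Order.TTheory GRing.Theory Num.Theory.
Local Open Scope ring_scope.

Definition pm1 := seq_sub [:: -1 : int; 1].
Definition pm1_val (s : pm1) : int := ssval s.
Coercion pm1_val : pm1 >-> int.

Definition tern := seq_sub [:: -1 : int; 0; 1].
Definition tern_val (t : tern) : int := ssval t.
Coercion tern_val : tern >-> int.

Definition cube (n : nat) := {ffun 'I_n -> pm1}.

Lemma pm1_neg_proof : (-1 : int) \in [:: -1 : int; 1].
Proof. by []. Qed.
Lemma pm1_pos_proof : (1 : int) \in [:: -1 : int; 1].
Proof. by []. Qed.

(* sgn 0 is undefined in the mathematics; here it takes the arbitrary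
   value -1. *)
Definition sgn (t : int) : pm1 :=
  if 0 < t then SeqSub pm1_pos_proof else SeqSub pm1_neg_proof.

(* As s is nonzero, sgn (- s) is the element of {-1, 1} with value - s. *)
Definition pm1_opp (s : pm1) : pm1 := sgn (- (s : int)).
Definition cube_opp (n : nat) (x : cube n) : cube n :=
  [ffun i => pm1_opp (x i)].

Section BooleanFunctions.
Variables (R : realFieldType) (n : nat).
Implicit Types (f : cube n -> pm1) (S : {set 'I_n}).

Definition cube_mean (g : cube n -> R) : R :=
  (\sum_(x : cube n) g x) / #|{: cube n}|%:R.

Definition unbiased f : Prop := cube_mean (fun x => (f x : int)%:~R) = 0.

Definition fourier f S : R :=
  cube_mean (fun x => (f x : int)%:~R * \prod_(i in S) (x i : int)%:~R).

Definition multilinear_ext f (z : 'I_n -> R) : R :=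
  \sum_(S : {set 'I_n}) fourier f S * \prod_(i in S) z i.

Definition erasure_pmf (p : R) (t : tern) : R :=
  if (t : int) == 0 then 1 - p else p / 2.

Definition Phi (p : R) f : R :=
  \sum_(z : {ffun 'I_n -> tern})
     (\prod_(i < n) erasure_pmf p (z i)) *
     `|multilinear_ext f (fun i => (z i : int)%:~R)|.

End BooleanFunctions.

Arguments unbiased R {n} f.

(* The coordinates x_1, ..., x_5 are indexed from 0: the numerals below denote
   elements of 'I_5. *)
Definition form5 (x : cube 5) : int :=
  (x 0 : int) - 3 * (x 1 : int) + (x 2 : int) - (x 3 : int) + 3 * (x 4 : int).

Definition f5 (x : cube 5) : pm1 := sgn (form5 x).

Definition Maj5 (x : cube 5) : pm1 := sgn (\sum_(i < 5) (x i : int)).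

(* Main.v *)
(** Condition on the first coordinate.  If [g] is a real function on the cube
    with restrictions [g+] and [g-] to [x_1 = 1] and [x_1 = -1], then
    [Phi_p g = p/2 (Phi_p g+ + Phi_p g-) + (1 - p) Phi_p ((g+ + g-) / 2)].
    At [p = 2/5], after clearing denominators, this is an integer recursion
    with [3 ^ 5] leaves, which is evaluated for both functions. *)
Require Import Defs.
From mathcomp Require Import all_boot all_order all_algebra.
From mathcomp Require Import ring lra.
Set Implicit Arguments.
Unset Strict Implicit.
Unset Printing Implicit Defensive.
Import Order.TTheory GRing.Theory Num.Theory.
Local Open Scope ring_scope.

(** * Sums over product spaces, one coordinate at a time *)

Definition ffun_cons (T : Type) (n : nat) (a : T) (y : {ffun 'I_n -> T}) :
  {ffun 'I_n.+1 -> T} := [ffun i => oapp y a (unlift ord0 i)].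

Lemma ffun_cons0 (T : Type) (n : nat) (a : T) (y : {ffun 'I_n -> T}) :
  ffun_cons a y ord0 = a.
Proof. by rewrite ffunE unlift_none. Qed.

Lemma ffun_consS (T : Type) (n : nat) (a : T) (y : {ffun 'I_n -> T}) i :
  ffun_cons a y (lift ord0 i) = y i.
Proof. by rewrite ffunE liftK. Qed.

(** [ffun_cons] is a bijection from pairs of a head and a tail. This serves for both sums in [Phi],
    over sign vectors and over erasure patterns. *)
Lemma big_ffun_recl (R : nmodType) (T : finType) (n : nat)
    (F : {ffun 'I_n.+1 -> T} -> R) :
  \sum_x F x = \sum_a \sum_y F (ffun_cons a y).
Proof.
rewrite pair_bigA /=.
rewrite (reindex (fun u : T * {ffun 'I_n -> T} => ffun_cons u.1 u.2)) //=.
exists (fun x => (x ord0, [ffun i => x (lift ord0 i)])) => [[a y]|x] _ /=.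
  rewrite ffun_cons0; congr pair.
  by apply/ffunP=> i; rewrite ffunE ffun_consS.
apply/ffunP=> i; rewrite ffunE.
by case: unliftP => [j ->|->] //=; rewrite ffunE.
Qed.

Lemma big_ffun0 (R : nmodType) (T : finType) (F : {ffun 'I_0 -> T} -> R) x0 :
  \sum_x F x = F x0.
Proof.
rewrite (big_pred1 x0) // => x; apply/esym/eqP/ffunP; by case.
Qed.

Lemma pm1P (s : pm1) : s = sgn 1 \/ s = sgn (-1).
Proof.
have: (s : int) \in [:: -1; 1] := ssvalP s.
by rewrite !inE => /orP[] /eqP e; [right | left]; apply: val_inj.
Qed.

Lemma sum_pm1 (R : nmodType) (F : pm1 -> R) :
  \sum_s F s = F (sgn 1) + F (sgn (-1)).
Proof.
rewrite (bigD1 (sgn 1)) //= (big_pred1 (sgn (-1))) // => s.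
by case: (pm1P s) => ->.
Qed.

Lemma tern0_proof : (0 : int) \in [:: -1 : int; 0; 1]. Proof. by []. Qed.
Lemma ternN_proof : (-1 : int) \in [:: -1 : int; 0; 1]. Proof. by []. Qed.
Lemma ternP_proof : (1 : int) \in [:: -1 : int; 0; 1]. Proof. by []. Qed.

Lemma sum_tern (R : nmodType) (F : tern -> R) :
  \sum_t F t =
    F (SeqSub tern0_proof) + (F (SeqSub ternP_proof) + F (SeqSub ternN_proof)).
Proof.
rewrite (bigD1 (SeqSub tern0_proof)) //= (bigD1 (SeqSub ternP_proof)) //=.
rewrite (big_pred1 (SeqSub ternN_proof)) // => -[k km].
(* Equality in [tern] is equality of the underlying integers, so it is enough to check the three
   members of the list. *)
change ((k != 0) && (k != 1) = (k == -1)).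
by move: km; rewrite !inE => /or3P[] /eqP ->.
Qed.

(** On sequences, fixing the first coordinate is [fun s => F (a :: s)], with no change of index
    type, and functions evaluate by plain list reduction. *)
Definition cube_seq n (x : cube n) : seq int :=
  [seq (x i : int) | i <- enum 'I_n].

Lemma cube_seq_cons n a (y : cube n) :
  cube_seq (ffun_cons a y) = (a : int) :: cube_seq y.
Proof.
rewrite /cube_seq enum_ordSl /= ffun_cons0 -map_comp; congr cons.
by apply: eq_map => i /=; rewrite ffun_consS.
Qed.

(** * The recursion on the first coordinate *)

Section Recursion.
Variable R : realFieldType.
Implicit Types (p : R) (F G : seq int -> R).

(* [2 ^ n * Phi p] for real functions of sign sequences, without Fourier
   coefficients *)
Definition scaled_Phi p n F : R :=
  \sum_(z : {ffun 'I_n -> tern}) (\prod_(i < n) erasure_pmf p (z i)) *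
    `|\sum_(x : cube n) F (cube_seq x) *
        \prod_(i < n) (1 + (x i : int)%:~R * (z i : int)%:~R)|.

(** Once the sums over S and x are interchanged, the inner sum is the expansion of the product over
    subsets S of the indices. *)
Lemma multilinear_extE n (f : cube n -> pm1) (z : 'I_n -> R) :
  multilinear_ext f z =
  (\sum_(x : cube n) (f x : int)%:~R * \prod_(i < n) (1 + (x i : int)%:~R * z i))
    / #|{: cube n}|%:R.
Proof.
rewrite /multilinear_ext /fourier /cube_mean.
under eq_bigr do rewrite mulrAC big_distrl /=.
rewrite -big_distrl /= exchange_big /=; congr (_ / _).
apply: eq_bigr => x _.
(* With 1 as the second summand, [bigA_distr] gives the factor 1 to every index outside S. *)
under [in RHS]eq_bigr do rewrite addrC.
rewrite bigA_distr big_distrr /=.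
apply: eq_bigr => S _; rewrite -mulrA -big_split /=; congr (_ * _).
by rewrite big_mkcond.
Qed.

Lemma card_pm1 : #|{: pm1}| = 2.
Proof. by rewrite card_seq_sub. Qed.

(** The factor [2 ^+ n] is the size of the cube; being positive, it leaves the absolute value. *)
Lemma Phi_scaled p n (f : cube n -> pm1) F :
  (forall x, F (cube_seq x) = (f x : int)%:~R) ->
  Phi p f = scaled_Phi p n F / 2 ^+ n.
Proof.
move=> fF; rewrite /scaled_Phi big_distrl; apply: eq_bigr => z _ /=.
rewrite multilinear_extE card_ffun card_pm1 card_ord natrX.
rewrite normrM [in X in _ * (_ * X)]ger0_norm ?invr_ge0 ?exprn_ge0 //.
rewrite mulrA; congr (_ * `|_| / _).
by apply: eq_bigr => x _; rewrite fF.
Qed.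

Lemma eq_scaled_Phi p n F G : F =1 G -> scaled_Phi p n F = scaled_Phi p n G.
Proof.
move=> FG; apply: eq_bigr => z _; congr (_ * `|_|).
by apply: eq_bigr => x _; rewrite FG.
Qed.

Lemma scaled_PhiZ p n F c :
  scaled_Phi p n (fun s => c * F s) = `|c| * scaled_Phi p n F.
Proof.
rewrite /scaled_Phi big_distrr; apply: eq_bigr => z _ /=.
rewrite [RHS]mulrCA -normrM; congr (_ * `|_|).
by rewrite big_distrr; apply: eq_bigr => x _; rewrite -mulrA.
Qed.

Lemma scaled_Phi0 p F : scaled_Phi p 0 F = `|F [::]|.
Proof.
have e (T : finType) : {ffun 'I_0 -> T} by apply: finfun; case.
rewrite /scaled_Phi (big_ffun0 _ (e _)) big_ord0 mul1r.
rewrite (big_ffun0 _ (e _)) big_ord0 mulr1.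
by rewrite /cube_seq (size0nil (size_enum_ord 0)).
Qed.

Lemma scaled_Phi_recl p n F :
  scaled_Phi p n.+1 F =
  \sum_(t : tern) erasure_pmf p t *
    scaled_Phi p n (fun s => F (1 :: s) * (1 + (t : int)%:~R) +
                             F (-1 :: s) * (1 - (t : int)%:~R)).
Proof.
rewrite /scaled_Phi big_ffun_recl; apply: eq_bigr => t _.
rewrite big_distrr; apply: eq_bigr => z _ /=.
rewrite big_ord_recl ffun_cons0 -mulrA; congr (_ * _).
rewrite (eq_bigr (fun i => erasure_pmf p (z i))); last first.
  by move=> i _; congr erasure_pmf; exact: ffun_consS.
congr (_ * `|_|).
rewrite big_ffun_recl sum_pm1 -big_split; apply: eq_bigr => x _ /=.
rewrite !cube_seq_cons !big_ord_recl !ffun_cons0 mul1r mulN1r.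
rewrite [RHS]mulrDl -!mulrA.
congr (_ + _); congr (_ * _); congr (_ * _); apply: eq_bigr => i _;
  by congr (1 + (pm1_val _)%:~R * (tern_val _)%:~R); exact: ffun_consS.
Qed.

(** An erased coordinate, t = 0, adds the two restrictions. For t = 1 or t = -1, one of the weights
    1 + t and 1 - t vanishes and the other is 2, which cancels the denominator of p / 2. *)
Lemma scaled_PhiS p n F :
  scaled_Phi p n.+1 F =
  (1 - p) * scaled_Phi p n (fun s => F (1 :: s) + F (-1 :: s)) +
  p * (scaled_Phi p n (fun s => F (1 :: s)) +
       scaled_Phi p n (fun s => F (-1 :: s))).
Proof.
rewrite scaled_Phi_recl sum_tern /erasure_pmf /=; congr (_ * _ + _).
  by apply: eq_scaled_Phi => s; rewrite addr0 subr0 !mulr1.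
have dbl G H : (forall s, G s = 2 * H s) ->
    scaled_Phi p n G = 2 * scaled_Phi p n H.
  by move=> GH; rewrite (eq_scaled_Phi _ _ GH) scaled_PhiZ ger0_norm.
rewrite [X in _ * X + _](dbl _ (fun s => F (1 :: s))); last first.
  by move=> s; rewrite /tern_val /=; ring.
rewrite [X in _ + _ * X](dbl _ (fun s => F (-1 :: s))); last first.
  by move=> s; rewrite /tern_val /=; ring.
by field.
Qed.

End Recursion.

(** * Exact evaluation at p = 2/5 *)

(* [10 ^ n * Phi (2 / 5)] for integer functions of sign sequences *)
Fixpoint int_Phi n (F : seq int -> int) : int :=
  if n is n'.+1 then
    3 * int_Phi n' (fun s => F (1 :: s) + F (-1 :: s)) +
    2 * (int_Phi n' (fun s => F (1 :: s)) + int_Phi n' (fun s => F (-1 :: s)))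
  else `|F [::]|.

(** The weights 1 - p = 3/5 and p = 2/5 become 3 and 2 when each level is multiplied by 5. *)
Lemma int_PhiE (R : realFieldType) n (F : seq int -> int) :
  scaled_Phi (2 / 5 : R) n (fun s => (F s)%:~R) = (int_Phi n F)%:~R / 5 ^+ n.
Proof.
elim: n F => [|n IHn] F; first by rewrite scaled_Phi0 -intr_norm expr0 divr1.
rewrite scaled_PhiS !IHn.
(* The induction hypothesis speaks of casts of integer functions, so the sum of two casts is turned
   into the cast of a sum. *)
rewrite (@eq_scaled_Phi _ _ _ _ (fun s => (F (1 :: s) + F (-1 :: s))%:~R)).
  rewrite IHn /= !rmorphD !rmorphM /= !rmorphD /= exprS.
  by field; rewrite expf_neq0 ?pnatr_eq0.
by move=> s; rewrite rmorphD.
Qed.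

Definition linear_form (w s : seq int) : int :=
  foldr +%R 0 [seq u.1 * u.2 | u <- zip w s].

(** The values are in [int] rather than [pm1] because the recursion adds restrictions, which leads
    out of {-1, 1}. *)
Definition threshold (w s : seq int) : int := sgn (linear_form w s).

Lemma Phi_threshold (R : realFieldType) n (w : seq int) (f : cube n -> pm1) :
  (forall x, f x = sgn (linear_form w (cube_seq x))) ->
  Phi (2 / 5 : R) f = (int_Phi n (threshold w))%:~R / 10 ^+ n.
Proof.
move=> fw.
rewrite (@Phi_scaled _ _ _ _ (fun s => (threshold w s)%:~R)).
  by rewrite int_PhiE -mulrA -invfM -exprMn -natrM.
by move=> x; rewrite fw.
Qed.

Lemma enum_ord5 : enum 'I_5 = [:: 0; 1; 2; 3; 4].
Proof. by apply: (inj_map val_inj); rewrite val_enum_ord. Qed.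

Lemma f5E x : f5 x = sgn (linear_form [:: 1; -3; 1; -1; 3] (cube_seq x)).
Proof.
by congr sgn; rewrite /cube_seq enum_ord5 /linear_form /form5 /=; ring.
Qed.

Lemma Maj5E x : Maj5 x = sgn (linear_form [:: 1; 1; 1; 1; 1] (cube_seq x)).
Proof.
congr sgn; rewrite /cube_seq -big_enum enum_ord5 /linear_form /= !mul1r.
by rewrite !big_cons big_nil.
Qed.

Lemma Phi_f5 (R : realFieldType) : Phi (2 / 5 : R) f5 = 2689 / 6250.
Proof.
rewrite (Phi_threshold R f5E).
(* Here 16 = 10^5 / 6250. *)
have -> : int_Phi 5 (threshold [:: 1; -3; 1; -1; 3]) = 16 * 2689.
  by apply/eqP; vm_compute.
by rewrite rmorphM /=; field.
Qed.

Lemma Phi_Maj5 (R : realFieldType) : Phi (2 / 5 : R) Maj5 = 5363 / 12500.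
Proof.
rewrite (Phi_threshold R Maj5E).
(* Here 8 = 10^5 / 12500. *)
have -> : int_Phi 5 (threshold [:: 1; 1; 1; 1; 1]) = 8 * 5363.
  by apply/eqP; vm_compute.
by rewrite rmorphM /=; field.
Qed.

(** * Oddness and unbiasedness *)

Lemma form5_neq0 (x : cube 5) : form5 x != 0.
Proof.
rewrite /form5.
by case: (pm1P (x 0)) (pm1P (x 1)) (pm1P (x 2)) (pm1P (x 3)) (pm1P (x 4))
  => -> [] -> [] -> [] -> [] ->.
Qed.

Lemma pm1_oppE (s : pm1) : (pm1_opp s : int) = - (s : int).
Proof. by case: (pm1P s) => ->. Qed.

(** At t = 0 the identity fails: the left side is -1 by convention and the right side is 1. *)
Lemma sgnN (t : int) : t != 0 -> sgn (- t) = pm1_opp (sgn t).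
Proof.
move=> t0; apply: val_inj; rewrite -[RHS]/(pm1_val _) pm1_oppE /sgn oppr_gt0.
by case: ltgtP t0.
Qed.

Lemma f5_opp (x : cube 5) : f5 (cube_opp x) = pm1_opp (f5 x).
Proof.
rewrite /f5 -sgnN ?form5_neq0 //; congr sgn.
by rewrite /form5 !ffunE !pm1_oppE; ring.
Qed.

Lemma cube_opp_inv n : involutive (@cube_opp n).
Proof.
move=> x; apply/ffunP => i; rewrite !ffunE; apply: val_inj.
by rewrite -[LHS]/(pm1_val _) !pm1_oppE opprK.
Qed.

(** The involution x -> -x permutes the cube and negates each term, so the sum equals its own
    negative. *)
Lemma odd_unbiased (R : realFieldType) n (f : cube n -> pm1) :
  (forall x, f (cube_opp x) = pm1_opp (f x)) -> unbiased R f.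
Proof.
move=> fN; rewrite /unbiased /cube_mean.
set s := \sum_x _; suff -> : s = 0 by rewrite mul0r.
have : s = - s.
  rewrite {1}/s (reindex_inj (inv_inj (@cube_opp_inv n))) -sumrN.
  by apply: eq_bigr => x _; rewrite fN pm1_oppE rmorphN.
lra.
Qed.

Theorem theorem1 (R : realFieldType) :
  [/\ forall x : cube 5, form5 x <> 0,
      forall x : cube 5, f5 (cube_opp x) = pm1_opp (f5 x)
    & unbiased R f5] /\
  [/\ Phi (2 / 5 : R) f5 = 2689 / 6250 /\ 2689 / 6250 = 43 / 10 ^+ 2 + 24 / 10 ^+ 5 :> R,
      Phi (2 / 5 : R) Maj5 = 5363 / 12500 /\
        5363 / 12500 = 42 / 10 ^+ 2 + 904 / 10 ^+ 5 :> R,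
      Phi (2 / 5 : R) Maj5 < Phi (2 / 5 : R) f5
    & ~ (forall g : cube 5 -> pm1, unbiased R g ->
           Phi (2 / 5 : R) g <= Phi (2 / 5 : R) Maj5)].
Proof.
have f5_unb : unbiased R f5 := odd_unbiased R f5_opp.
have lt_Maj5_f5 : Phi (2 / 5 : R) Maj5 < Phi (2 / 5 : R) f5.
  by rewrite Phi_f5 Phi_Maj5; lra.
split; split=> //.
- by move=> x; apply/eqP/form5_neq0.
- exact: f5_opp.
- by split; [exact: Phi_f5 | field].
- by split; [exact: Phi_Maj5 | field].
- by move=> /(_ f5 f5_unb); rewrite leNgt lt_Maj5_f5.
Qed.
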